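(* There exists a set $E\subseteq\mathbb{N}^2$ such that the set $U$ of parameters $(u,v)\in\mathbb{R}^2$ for which \[D(E\cap t_{u,v})=D(E)=1\] satisfies \[\lim_{M\to\infty}\frac{|U\cap[-M,M]^2|}{(2M)^2}>0,\] where $|\cdot|$ denotes two-dimensional Lebesgue measure.
   Context: For a $1$-separated set $E\subset\mathbb{R}^2$ (in particular for any $E\subseteq\mathbb{Z}^2$), the counting dimension $D(E)$ is \[D(E)=\limsup_{\|C\|\to\infty}\frac{\log|E\cap C|}{\log\|C\|},\] where $|E\cap C|$ is the number of points of $E\cap C$, $C\subset\mathbb{R}^2$ ranges over arbitrary squares (placed anywhere in the plane) with sides parallel to the coordinate axes, $\|C\|$ is the side length of $C$, and the limsup means $\lim_{R\to\infty}\sup_{\|C\|\ge R}$. For $u,v\in\mathbb{R}$ with $u\neq0$, the width-1 tube $t_{u,v}$ is \[t_{u,v}=\Big\{(x,y)\in\mathbb{R}^2 : -\tfrac1u x+v\sqrt{1+\tfrac1{u^2}}<y\le-\tfrac1u x+(v+1)\sqrt{1+\tfrac1{u^2}}\Big\}.\] The line through the origin perpendicular to it has slope $u$. For $u=0$, $t_{0,v}=\{(x,y)\in\mathbb{R}^2: v<x\le v+1\}$ (vertical tube). *)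

(* Defs.v *)
From HB Require Import structures.
From mathcomp Require Import all_boot all_order all_algebra.
From mathcomp Require Import all_classical all_reals all_analysis.

Set Implicit Arguments.
Unset Strict Implicit.
Unset Printing Implicit Defensive.

Import Order.TTheory GRing.Theory Num.Theory.
Import numFieldNormedType.Exports.

Local Open Scope classical_set_scope.
Local Open Scope ring_scope.

Definition square (R : realType) (a b l : R) : set (R * R) :=
  `[a, a + l] `*` `[b, b + l].

(* [lne] sends a count of 0 to -oo, so squares missing [E] do not contribute
   to the supremum; only [1 < r] matters for the limit, so that [ln l > 0]. *)
Definition sup_log_count (R : realType) (E : set (R * R)) (r : R) : \bar R :=
  ereal_sup [set x | exists a b l : R, r <= l /\
    x = (lne (counting (E `&` square a b l)) / (ln l)%:E)%E].

(* The limit always exists, since [sup_log_count E] is nonincreasing on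
   ]1, +oo[. *)
Definition counting_dim (R : realType) (E : set (R * R)) : \bar R :=
  lim (sup_log_count E r @[r --> +oo]).

Definition tube (R : realType) (u v : R) : set (R * R) :=
  if u == 0 then [set z | v < z.1 <= v + 1]
  else [set z | - u^-1 * z.1 + v * Num.sqrt (1 + (u ^+ 2)^-1) < z.2
                <= - u^-1 * z.1 + (v + 1) * Num.sqrt (1 + (u ^+ 2)^-1)].

Definition nat_points (R : realType) : set (R * R) :=
  [set (m%:R, n%:R) | m in [set: nat] & n in [set: nat]].

Arguments nat_points : clear implicits.

Definition good_parameters (R : realType) (E : set (R * R)) : set (R * R) :=
  [set p | counting_dim (E `&` tube p.1 p.2) = counting_dim E /\
           counting_dim E = 1%E].

Definition lebesgue2 (R : realType) : set (R * R) -> \bar R :=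
  (@lebesgue_measure R \x @lebesgue_measure R)%E.

(* Main.v *)
Require Import Defs.
From mathcomp Require Import all_boot all_order all_algebra.
From mathcomp Require Import all_classical all_reals all_analysis.
From mathcomp Require Import lra ring.
Import Order.TTheory GRing.Theory Num.Theory.
Import numFieldNormedType.Exports.
Local Open Scope classical_set_scope.
Local Open Scope ring_scope.

(** Take E = {(m, n) : |m sigma(m) - n| <= 2} with sigma(m) = h sin h and
    h = ln (ln (m + 2)).  Each column contains at most five points of E, so that
    D(E) <= 1.  The function sigma oscillates between -oo and +oo, while
    (m + 1) (sigma(m + 1) - sigma(m)) tends to 0.  Hence the curve
    y = x sigma(x) crosses every line y = s x + b infinitely often, and at a far
    enough crossing it follows the line within distance 1 for as many columns as
    desired: for u < 0 the tube t_{u,v}, of slope -1/u > 0, contains about l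
    points of E in suitable squares of side O(l), with l arbitrarily large.
    For u >= 0 the tube meets E in a finite set.  So U = {u < 0} x R, whose
    density is 1/2. *)

(** * Iterated logarithms and the oscillating slope *)

Section Slope.
Context {R : realType}.
Implicit Types (x y z e s b : R) (m n k : nat).

Lemma sin_lipschitz y z : `|sin y - sin z| <= `|y - z|.
Proof.
wlog yz : y z / z <= y.
  move=> H; case: (leP z y) => [|/ltW]; first exact: H.
  by rewrite distrC (distrC y); exact: H.
have [x _ ->] : exists2 x, x \in `[z, y] & sin y - sin z = cos x * (y - z).
  apply: MVT_segment => // t; apply: continuous_subspaceT.
  exact: continuous_sin.
by rewrite normrM ler_piMl// cos_max.
Qed.

Definition swing y : R := y * sin y.

Lemma swing_lipschitz y z : `|swing y - swing z| <= (1 + `|z|) * `|y - z|.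
Proof.
have -> : swing y - swing z = (y - z) * sin y + z * (sin y - sin z).
  by rewrite /swing; ring.
rewrite (le_trans (ler_normD _ _))// !normrM mulrDl mul1r lerD//.
  by rewrite ler_piMr// sin_max.
by rewrite ler_wpM2l// sin_lipschitz.
Qed.

Definition loglog m : R := ln (ln m.+2%:R).

Let ln2_gt0 m : 0 < ln (m.+2%:R : R).
Proof. by rewrite ln_gt0// ltr1n. Qed.

(** The bound [ln (1 + x) <= x] is used twice: with N = m + 2, ln (N + 1) = ln N + ln (1 + 1/N), and
    the ratio of the two logarithms is at most 1 + 1/(N ln N). *)
Lemma loglog_step m :
  0 <= loglog m.+1 - loglog m <= (m.+2%:R * ln m.+2%:R)^-1.
Proof.
rewrite /loglog; set N : R := m.+2%:R.
have N0 : 0 < N by rewrite ltr0n.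
have L0 : 0 < ln N by exact: ln2_gt0.
have L1 : 0 < ln m.+3%:R :> R by exact: ln2_gt0.
have NE : m.+3%:R = N * (1 + N^-1).
  by rewrite mulrDr mulr1 divff ?gt_eqF// /N -natr1.
have lnE : ln m.+3%:R = ln N + ln (1 + N^-1).
  by rewrite NE lnM// posrE// addr_gt0// invr_gt0.
have lnN : 0 <= ln (1 + N^-1) <= N^-1.
  have N'0 : 0 < N^-1 by rewrite invr_gt0.
  apply/andP; split; first by rewrite ln_ge0// lerDl ltW.
  by rewrite le_ln1Dx// (lt_trans (y := 0))// ltrN10.
apply/andP; split.
  by rewrite subr_ge0 ler_ln ?posrE// lnE lerDl; case/andP: lnN.
rewrite -ln_div ?posrE//.
have -> : ln m.+3%:R / ln N = 1 + ln (1 + N^-1) / ln N.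
  by rewrite lnE mulrDl divff// gt_eqF.
apply: le_trans (le_ln1Dx _) _.
  apply: (lt_le_trans (ltrN10 _)); apply: divr_ge0; last exact: ltW.
  by case/andP: lnN.
by rewrite invfM ler_wpM2r ?invr_ge0 ?(ltW L0)//; case/andP: lnN.
Qed.

Lemma loglog_le_mono m n : (m <= n)%N -> loglog m <= loglog n.
Proof.
move=> mn; rewrite /loglog ler_ln ?posrE ?ln2_gt0//.
by rewrite ler_ln ?posrE ?ltr0n// ler_nat.
Qed.

Lemma loglog_unbounded y : exists m, y <= loglog m.
Proof.
exists (Num.trunc (expR (expR y))).
rewrite -{1}(expRK y) ler_ln ?posrE ?expR_gt0 ?ln2_gt0//.
rewrite -{1}(expRK (expR y)) ler_ln ?posrE ?expR_gt0 ?ltr0n//.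
by rewrite (le_trans (ltW (truncnS_gt _)))// ler_nat.
Qed.

(** The bound on (m + 1) |slope (m + 1) - slope m| that [swing_lipschitz] provides. *)
Definition loglog_gap m : R :=
  m.+1%:R * ((1 + `|loglog m.+1|) * (loglog m.+1 - loglog m)).

(** With h = [loglog m], the step is at most 1/((m + 2) exp h) and at most 1, so the gap is at most
    (2 + h)/exp h, which tends to 0. *)
Lemma loglog_gap_small e : 0 < e -> exists M, forall m, (M <= m)%N ->
  loglog_gap m <= e.
Proof.
move=> e0.
have [M HM] := loglog_unbounded (`|4 / e|).
have [M' HM'] := loglog_unbounded 1.
exists (maxn M M') => m; rewrite geq_max => /andP[Mm M'm].
(* Since exp h >= (1 + h/2)^2, the gap is at most 4/(2 + h), hence at most e once h >= 4/e. *)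
have h4 : 4 / e <= loglog m.
  by rewrite (le_trans (ler_norm _))// (le_trans HM)// loglog_le_mono.
have h0 : 0 <= loglog m.
  by rewrite (le_trans _ (loglog_le_mono _ _ M'm))// (le_trans _ HM').
have /andP[d0 d1] := loglog_step m.
have L1 : (1 + loglog m / 2) ^+ 2 <= ln m.+2%:R :> R.
  have -> : ln m.+2%:R = expR (loglog m / 2) ^+ 2 :> R.
    by rewrite -expRM_natl mulrC divfK ?lnK ?posrE ?ln2_gt0// pnatr_eq0.
  by rewrite lerXn2r ?nnegrE ?expR_ge0 ?addr_ge0 ?divr_ge0// expR_ge1Dx.
have L0 := ln2_gt0 m.
have N0 : 0 < m.+2%:R :> R by rewrite ltr0n.
have d2 : loglog m.+1 - loglog m <= 1.
  apply: le_trans d1 _; rewrite invf_le1 ?mulr_gt0//.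
  have : 1 <= m.+2%:R :> R by rewrite ler1n.
  by nra.
rewrite /loglog_gap ger0_norm; last by lra.
have -> : e = m.+2%:R * ((e * ln m.+2%:R) * (m.+2%:R * ln m.+2%:R)^-1).
  by field; rewrite !gt_eqF.
apply: ler_pM => //.
- by rewrite mulr_ge0// addr_ge0//; lra.
- by rewrite ler_nat.
apply: ler_pM => //; first by lra.
have h4e : 4 <= loglog m * e by rewrite -ler_pdivrMr.
have : e * (1 + loglog m / 2) ^+ 2 <= e * ln m.+2%:R by rewrite ler_pM2l.
move=> L2; apply: le_trans L2.
have h4e' : (2 + loglog m) * 4 <= (2 + loglog m) * (loglog m * e + 2 * e).
  by apply: ler_wpM2l; lra.
have -> : e * (1 + loglog m / 2) ^+ 2
    = (2 + loglog m) * (loglog m * e + 2 * e) / 4 by field.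
by lra.
Qed.

Definition slope m : R := swing (loglog m).

Lemma slope_step e : 0 < e -> exists M, forall m, (M <= m)%N ->
  m.+1%:R * `|slope m.+1 - slope m| <= e.
Proof.
move=> /loglog_gap_small[M HM]; exists M => m /HM; apply: le_trans.
rewrite /loglog_gap ler_wpM2l// distrC (le_trans (swing_lipschitz _ _))//.
by rewrite distrC (@ger0_norm _ (_ - _))//; case/andP: (loglog_step m).
Qed.

(** A large y lies between two consecutive values of [loglog], and across such an interval [swing]
    varies by at most [loglog_gap], which is eventually at most 1. *)
Lemma slope_near_swing M : exists Y, forall y, Y <= y ->
  exists m, (M <= m)%N /\ `|slope m - swing y| <= 1.
Proof.
have [M1 HM1] := loglog_gap_small 1 ltr01.
exists (Num.max (loglog (maxn M M1)) 0) => y.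
rewrite ge_max => /andP[My y0].
pose N := Num.trunc (expR (expR y)).
have /andP[N1 N2] : N%:R <= expR (expR y) < N.+1%:R.
  by rewrite truncn_itv// expR_ge0.
have yE : y = ln (ln (expR (expR y))) by rewrite !expRK.
have NM : (maxn M M1 + 2 <= N)%N.
  rewrite truncn_ge_nat ?expR_ge0// addn2.
  move: My; rewrite {1}yE /loglog ler_ln ?posrE ?ln2_gt0 ?expRK ?expR_gt0//.
  by rewrite -{1}(expRK (expR y)) ler_ln ?posrE ?expR_gt0.
(* Here m + 2 is the integer part of exp (exp y), which places y between [loglog m] and
   [loglog m.+1]. *)
pose m := (N - 2)%N.
have mN : m.+2 = N by rewrite /m -addn2 subnK// (leq_trans _ NM)// leq_addl.
have mM : (maxn M M1 <= m)%N.
  by rewrite /m leq_subRL ?(leq_trans _ NM) ?leq_addl// addnC.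
exists m; split; first exact: leq_trans (leq_maxl _ _) mM.
have h1 : loglog m <= y.
  rewrite [leRHS]yE ler_ln ?posrE ?ln2_gt0 ?expRK ?expR_gt0//.
  by rewrite -(expRK (expR y)) ler_ln ?posrE ?expR_gt0// mN.
have h2 : y <= loglog m.+1.
  rewrite [leLHS]yE ler_ln ?posrE ?ln2_gt0 ?expRK ?expR_gt0//.
  by rewrite -(expRK (expR y)) ler_ln ?posrE ?expR_gt0// mN ltW.
apply: le_trans (swing_lipschitz _ _) _.
apply: le_trans (HM1 m (leq_trans (leq_maxr _ _) mM)).
rewrite distrC ger0_norm ?subr_ge0// ger0_norm// /loglog_gap.
rewrite -[leLHS]mul1r ler_pM//; first by rewrite mulr_ge0 ?subr_ge0// addr_ge0.
  by rewrite ler1n.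
apply: ler_pM; rewrite ?subr_ge0//; first by rewrite addr_ge0.
  by rewrite lerD2l ger0_norm// (le_trans y0).
  by rewrite lerD2r.
by rewrite subr_ge0.
Qed.

Lemma sin_frequently a y : exists z, y <= z /\ sin z = sin a.
Proof.
pose n := (Num.trunc `|y - a|).+1.
exists (a + pi *+ 2 *+ n); split; last exact: (periodicn (@sinD2pi R)).
rewrite -lerBlDl (le_trans (ler_norm _))// (le_trans (ltW (truncnS_gt _)))//.
by rewrite -[leRHS]mulr_natl ler_peMr// mulr2n; have := pi_ge2 R; lra.
Qed.

Lemma slope_frequently_gt M y : exists m, (M <= m)%N /\ y < slope m.
Proof.
have [Y HY] := slope_near_swing M.
(* Where the sine is 1, [swing z] is z itself; the margin 2 absorbs the error 1 of
   [slope_near_swing] and leaves a strict inequality. *)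
have [z [yz sz]] := sin_frequently (pi / 2) (Num.max Y (y + 2)).
move: yz; rewrite ge_max => /andP[Yz yz].
have [m [Mm]] := HY _ Yz; rewrite /swing sz sin_pihalf mulr1 => hm.
by exists m; split => //; move: hm; rewrite ler_norml => /andP[? ?]; lra.
Qed.

Lemma slope_frequently_lt M y : exists m, (M <= m)%N /\ slope m < y.
Proof.
have [Y HY] := slope_near_swing M.
have [z [yz sz]] := sin_frequently (- (pi / 2)) (Num.max Y (2 - y)).
move: yz; rewrite ge_max => /andP[Yz yz].
have [m [Mm]] := HY _ Yz; rewrite /swing sz sinN sin_pihalf mulrN1 => hm.
by exists m; split => //; move: hm; rewrite ler_norml => /andP[? ?]; lra.
Qed.

(* Writing d m for the difference, one has
   d (m+1) - d m = (d m + b) / m + (m+1) (slope (m+1) - slope m), which tends to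
   0 as long as |d| <= 1; and d changes sign from negative to positive
   arbitrarily far. *)
Lemma slope_follows_line s b k M : exists m0, (M <= m0)%N /\
  forall i, (i < k)%N ->
    `|(m0 + i)%:R * slope (m0 + i) - (s * (m0 + i)%:R + b)| <= 1.
Proof.
pose d m := m%:R * slope m - (s * m%:R + b).
(* Each step may change d by at most eta, so that k + 1 steps stay within 1. *)
pose eta : R := k.+1%:R^-1.
have eta0 : 0 < eta by rewrite invr_gt0 ltr0n.
have [M1 HM1] := slope_step (eta / 2) (divr_gt0 eta0 (ltr0n _ 2)).
pose M2 := (Num.trunc (2 * (1 + `|b|) / eta)).+1.
pose N := maxn M (maxn M1 M2).
(* The summand 1/m in the bound is reserved for the term d m / m, under |d m| <= 1. *)
have dS m : (N <= m)%N -> exists2 r, d m.+1 = d m + d m * m%:R^-1 + r &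
    `|r| + m%:R^-1 <= eta.
  rewrite !geq_max => /and3P[_ M1m M2m].
  have m0 : 0 < m%:R :> R by rewrite ltr0n; exact: leq_trans M2m.
  exists (b / m%:R + m.+1%:R * (slope m.+1 - slope m)).
    by rewrite /d -!natr1; field; rewrite gt_eqF.
  have hs := HM1 m M1m.
  have hb : (1 + `|b|) / m%:R <= eta / 2.
    rewrite ler_pdivrMr// mulrC -ler_pdivrMr ?divr_gt0//.
    rewrite invf_div mulrA (mulrC _ 2) (le_trans (ltW (truncnS_gt _)))//.
    by rewrite ler_nat.
  have := ler_normD (b / m%:R) (m.+1%:R * (slope m.+1 - slope m)).
  rewrite !normrM normfV (gtr0_norm m0) (@ger0_norm _ m.+1%:R)//.
  by move: hb hs; rewrite mulrDl mul1r; lra.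
(* The offset |b| outweighs b in d, because m >= 1. *)
have [m1 [Nm1 sm1]] := slope_frequently_lt N (s - `|b|).
have [m2 [m12 sm2]] := slope_frequently_gt m1 (s + `|b|).
have m1gt0 m : (m1 <= m)%N -> 1 <= m%:R :> R.
  move=> m1m; rewrite ler1n (leq_trans _ m1m)// (leq_trans _ Nm1)//.
  by rewrite /N !leq_max ltn0Sn !orbT.
have lb := ler_norm b; have lNb := ler_norm (- b); rewrite normrN in lNb.
have dm1 : d m1 <= 0.
  by have := m1gt0 m1 (leqnn _); rewrite /d; have := normr_ge0 b; nra.
have dm2 : 0 < d m2.
  by have := m1gt0 m2 m12; rewrite /d; have := normr_ge0 b; nra.
have [m [m1m [dm dmS]]] : exists m, (m1 <= m)%N /\ d m <= 0 /\ 0 < d m.+1.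
  have [j jP] : {j | m2 = (m1 + j)%N} by exists (m2 - m1)%N; rewrite subnKC.
  rewrite jP in dm2; elim: j dm2 {jP} => [|j IH].
    by rewrite addn0 => /(le_lt_trans dm1); rewrite ltxx.
  case: (ltP 0 (d (m1 + j)%N)) => [/IH//|dj]; rewrite addnS => djS.
  by exists (m1 + j)%N; rewrite leq_addr.
have Nm : (N <= m)%N by exact: leq_trans m1m.
have etak i : (i <= k)%N -> i.+1%:R * eta <= 1.
  by move=> ik; rewrite ler_pdivrMr ?ltr0n// mul1r ler_nat.
exists m.+1; split.
  by rewrite (leq_trans _ (leqW Nm))// leq_maxl.
move=> i ik; rewrite -[X in X <= _]/(`|d (m.+1 + i)%N|).
suff : `|d (m.+1 + i)%N| <= i.+1%:R * eta by move/le_trans; apply; exact/etak/ltnW.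
elim: i ik => [_|i IH ik].
  (* At the crossing d m <= 0 < d (m + 1), so d (m + 1) <= r <= eta. *)
  rewrite addn0 mul1r gtr0_norm//; have [r -> re] := dS m Nm.
  have := ler_norm r; have : 0 <= m%:R^-1 :> R by rewrite invr_ge0.
  by nra.
have {}IH := IH (ltnW ik).
have [|r re] := dS (m.+1 + i)%N; first by rewrite (leq_trans Nm)// ltnW// ltn_addr.
have d1 := le_trans IH (etak _ (ltnW (ltnW ik))).
set w := (_^-1) in re *.
have w0 : 0 <= w by rewrite invr_ge0.
rewrite addnS => wr; rewrite re -[i.+2%:R]natr1 [leRHS]mulrDl mul1r.
rewrite (le_trans (ler_normD _ _))// (le_trans (lerD (ler_normD _ _) (lexx _)))//.
rewrite -addrA lerD// (le_trans _ wr)// addrC lerD2l normrM (ger0_norm w0).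
by rewrite ler_piMl.
Qed.

End Slope.

(** * Counting lattice points near a graph *)

Section Counting.
Context {R : realType}.

Lemma counting_le_size (T : choiceType) (A : set T) (t : seq T) :
  A `<=` [set` t] -> (counting A <= (size t)%:R%:E :> \bar R)%E.
Proof.
move=> At; have fA : finite_set A by exact: sub_finite_set At (finite_seq t).
rewrite /counting asboolT// lee_fin ler_nat.
by apply: uniq_leq_size => // x; rewrite in_fset_set// inE => /At.
Qed.

Lemma size_le_counting (T : choiceType) (A : set T) (t : seq T) :
  uniq t -> [set` t] `<=` A -> ((size t)%:R%:E <= counting A :> \bar R)%E.
Proof.
move=> ut tA; rewrite /counting; case: asboolP => [fA|_]; last exact: leey.
rewrite lee_fin ler_nat; apply: uniq_leq_size => // x xt.
by rewrite in_fset_set// inE; exact: tA.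
Qed.

Lemma le_counting (T : choiceType) (A B : set T) :
  A `<=` B -> (counting A <= counting B :> \bar R)%E.
Proof.
move=> AB; rewrite [leRHS]/counting; case: asboolP => [fB|_]; last exact: leey.
by apply: counting_le_size => x /AB Bx; rewrite /= in_fset_set// inE.
Qed.

(** The tolerance 2 allows 1 for the distance from the curve to a line and 1 for rounding the line
    up to an integer. *)
Definition near_graph (f : nat -> R) : set (R * R) :=
  [set z | exists m n, z = (m%:R, n%:R) /\ `|f m - n%:R| <= 2].

Lemma near_graph_nat f : near_graph f `<=` nat_points R.
Proof. by move=> z [m [n [-> _]]]; exists m => //; exists n. Qed.

(** At most l + 2 columns meet the strip, and an interval of length 4 holds at most five
    integers. *)
Lemma counting_near_graph f (a l : R) : 0 <= l ->
  (counting (near_graph f `&` [set z : R * R | (a <= z.1 <= a + l)%R])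
    <= (5 * (l + 2) : R)%R%:E :> \bar R)%E.
Proof.
(* On negative reals [Num.trunc] is 0, still a lower bound for the coordinates, which are natural
   numbers. *)
move=> l0; pose m0 := Num.trunc a; pose n0 m := Num.trunc (f m - 2).
pose k := (Num.trunc l).+2.
pose t := [seq ((m0 + i)%:R, (n0 (m0 + i)%N + j)%:R) : R * R
           | i <- iota 0 k, j <- iota 0 5].
apply: (@le_trans _ _ (size t)%:R%:E); last first.
  rewrite lee_fin size_allpairs !size_iota natrM mulrC ler_wpM2l//.
  by rewrite /k -addn2 natrD lerD2r truncn_le.
apply: counting_le_size => _ [[m [n [-> /= fmn]]] /andP[am mal]].
have m0m : (m0 <= m)%N.
  case: (leP 0 a) => [a0|/ltW a0].
    by rewrite -(ler_nat R) (le_trans _ am)// truncn_le.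
  by rewrite /m0 truncn_le_nat (le_lt_trans a0).
have n0n : (n0 m <= n)%N.
  case: (leP 0 (f m - 2)) => [f0|/ltW f0].
    rewrite -(ler_nat R) (@le_trans _ _ (f m - 2))// ?truncn_le//.
    by move: fmn; rewrite ler_norml => /andP[? ?]; lra.
  by rewrite /n0 truncn_le_nat (le_lt_trans f0).
apply/allpairsP; exists ((m - m0)%N, (n - n0 m)%N); split.
- rewrite mem_iota add0n /= ltn_subLR// -(ltr_nat R) natrD /k -natr1.
  have := truncnS_gt a; rewrite -/m0 -natr1.
  by have := truncnS_gt l; lra.
- rewrite mem_iota add0n /= ltn_subLR// -(ltr_nat R) natrD.
  have := truncnS_gt (f m - 2); rewrite -/(n0 m) -natr1.
  by move: fmn; rewrite ler_norml => /andP[? ?]; lra.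
- by rewrite /= !subnKC.
Qed.

End Counting.

(** * Criteria for counting dimension 1 or different from 1 *)

Section CountingDimension.
Context {R : realType}.
Implicit Types (E : set (R * R)) (a b c l r K : R).

Lemma lne_div_le (x : \bar R) K l : 0 < K -> 1 < l -> (x <= K%:E)%E ->
  (lne x / (ln l)%:E <= (ln K / ln l)%:E)%E.
Proof.
move=> K0 l1 xK; have L0 : 0 < ln l by rewrite ln_gt0.
rewrite inver gt_eqF// EFinM lee_pmul2r ?lte_fin ?invr_gt0//.
case: (leP x 0%E) => [x0|x0]; first by rewrite le0_lneNy// leNye.
by rewrite -lne_EFin// lee_lne ?in_itv/= ?leey ?andbT ?lee_fin ?(ltW x0) ?(ltW K0).
Qed.

Lemma le_lne_div (x : \bar R) K l : 0 < K -> 1 < l -> (K%:E <= x)%E ->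
  ((ln K / ln l)%:E <= lne x / (ln l)%:E)%E.
Proof.
move=> K0 l1 Kx; have L0 : 0 < ln l by rewrite ln_gt0.
rewrite inver gt_eqF// EFinM lee_pmul2r ?lte_fin ?invr_gt0//.
rewrite -lne_EFin// lee_lne ?in_itv/= ?leey ?andbT ?lee_fin ?(ltW K0)//.
by rewrite (le_trans _ Kx)// lee_fin ltW.
Qed.

Lemma cvg_ln_pinfty : @ln R x @[x --> +oo] --> +oo.
Proof.
apply/cvgryPge => A; near=> x.
by rewrite -(expRK A) ler_ln ?posrE ?expR_gt0.
Unshelve. all: by end_near. Qed.

Lemma cvg_div_ln_pinfty c : c / ln x @[x --> +oo] --> 0.
Proof.
rewrite -[X in _ --> X](mulr0 c); apply: cvgMr => /=.
apply/gtr0_cvgV0; last exact: cvg_ln_pinfty.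
by near=> x; apply: ln_gt0.
Unshelve. all: by end_near. Qed.

Lemma sup_log_count_le1D E c r : 1 <= c -> 1 < r ->
  (forall a b l, 1 <= l -> (counting (E `&` square a b l) <= (c * l)%:E)%E) ->
  (sup_log_count E r <= (1 + ln c / ln r)%:E)%E.
Proof.
move=> c1 r1 Ec; apply: ge_ereal_sup => _ [a [b [l [rl ->]]]].
have c0 : 0 < c by exact: lt_le_trans c1.
have l1 : 1 < l by exact: lt_le_trans rl.
have l0 : 0 < l by exact: lt_trans l1.
have Ll : 0 < ln l by rewrite ln_gt0.
apply: le_trans (lne_div_le _ _ _ (mulr_gt0 c0 l0) l1 (Ec a b l (ltW l1))) _.
rewrite lee_fin lnM// mulrDl divff ?gt_eqF// addrC lerD2l.
rewrite ler_wpM2l ?ln_ge0// lef_pV2 ?posrE ?ln_gt0//.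
by rewrite ler_ln// ?posrE// (lt_trans _ r1).
Qed.

(** The quotient ln k / ln (c k) = 1 - ln c / ln (c k) comes arbitrarily close to 1 as k grows. *)
Lemma sup_log_count_ge1 E c r : 1 <= c ->
  (forall k, (0 < k)%N ->
    exists a b,
      (k%:R%:E <= counting (E `&` square a b (c * k%:R)) :> \bar R)%E) ->
  (1 <= sup_log_count E r)%E.
Proof.
move=> c1 Ec; apply/lee_addgt0Pr => e e0.
(* The first summand makes the side c k at least r, the second makes ln c <= e ln (c k). *)
pose k := (Num.trunc (`|r| + expR (ln c / e))).+1.
have kr : `|r| + expR (ln c / e) < k%:R by exact: truncnS_gt.
have c0 : 0 < c by exact: lt_le_trans c1.
have k0 : 0 < k%:R :> R by rewrite ltr0n.
have rk : `|r| + expR (ln c / e) < c * k%:R.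
  by rewrite (lt_le_trans kr)// ler_peMl// ltW.
have ek : expR (ln c / e) < c * k%:R.
  by rewrite (le_lt_trans _ rk)// lerDr.
have ck1 : 1 < c * k%:R.
  by rewrite (le_lt_trans _ ek)// -expR0 ler_expR divr_ge0 ?ln_ge0// ltW.
have Lck : 0 < ln (c * k%:R) by rewrite ln_gt0.
have [a [b kE]] := Ec k isT.
have := le_lne_div _ _ _ k0 ck1 kE => /le_trans/(_ (ereal_sup_ubound _)) H.
rewrite -leeBlDr//; apply: le_trans (H _ _); last first.
  exists a, b, (c * k%:R); split => //.
  by rewrite (le_trans (ler_norm _))// ltW// (le_lt_trans _ rk)// lerDl expR_ge0.
rewrite -EFinB lee_fin ler_pdivlMr//.
have Lc : ln c <= e * ln (c * k%:R).
  rewrite -ler_pdivrMl// mulrC -[leLHS]expRK.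
  by rewrite ler_ln ?posrE ?expR_gt0 ?(lt_trans ltr01 ck1) ?ltW.
by move: Lc; rewrite lnM ?posrE// mulrBl mul1r; lra.
Qed.

Lemma counting_dim_eq1 E c c' : 1 <= c -> 1 <= c' ->
  (forall a b l, 1 <= l -> (counting (E `&` square a b l) <= (c * l)%:E)%E) ->
  (forall k, (0 < k)%N ->
    exists a b,
      (k%:R%:E <= counting (E `&` square a b (c' * k%:R)) :> \bar R)%E) ->
  counting_dim E = 1%E.
Proof.
move=> c1 c'1 ubE lbE; apply: cvg_lim => //.
apply: (@squeeze_cvge _ _ _ _ (cst 1%E) _ (fun r => (1 + ln c / ln r)%:E)).
- near=> r; apply/andP; split; first exact: sup_log_count_ge1 _ _ _ c'1 lbE.
  by exact: sup_log_count_le1D ubE.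
- exact: cvg_cst.
- apply: cvg_EFin; first by near=> r.
  rewrite -[X in _ --> X]addr0; apply: cvgD; first exact: cvg_cst.
  exact: cvg_div_ln_pinfty.
Unshelve. all: by end_near. Qed.

(** A bounded count keeps the quotients at most 1/2 for large squares, so that a limit, if there is
    one, is at most 1/2. *)
Lemma counting_dim_neq1 E c :
  (counting E <= c%:E)%E -> counting_dim E <> 1%E.
Proof.
move=> Ec; rewrite /counting_dim.
(* [lim] of a divergent function is the default point 0. *)
have [cv|/dvgP ->] := pselect (cvg (sup_log_count E r @[r --> +oo])); last first.
  by case=> /esym/eqP; rewrite oner_eq0.
pose K := Num.max 1 c; have K0 : 0 < K by rewrite lt_max ltr01.
have := @lime_le _ _ _ _ (2^-1)%:E _ cv => /[swap] -> => h.
have : (1 <= (2^-1 : R)%:E)%E; last by rewrite lee_fin invf_ge1// (ler_nat _ 2 1).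
apply: (h _); near=> r.
have r1 : 1 < r by near: r; apply: nbhs_pinfty_gt; exact: num_real.
(* For l >= r this gives ln K / ln l <= 1/2. *)
have rK : K ^+ 2 <= r by near: r; apply: nbhs_pinfty_ge; exact: num_real.
apply: ge_ereal_sup => _ [a [b [l [rl ->]]]].
have l1 : 1 < l by exact: lt_le_trans rl.
have Ecl : (counting (E `&` square a b l) <= K%:E)%E.
  apply: le_trans (le_counting _ _ _ (@subIsetl _ _ _)) _.
  by apply: le_trans Ec _; rewrite lee_fin le_max lexx orbT.
apply: le_trans (lne_div_le _ _ _ K0 l1 Ecl) _.
rewrite lee_fin ler_pdivrMr ?ln_gt0// mulrC ler_pdivlMr// mulr_natr -lnXn//.
by rewrite ler_ln ?posrE ?exprn_gt0 ?(lt_trans ltr01 l1)//; exact: le_trans rl.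
Unshelve. all: by end_near. Qed.

End CountingDimension.

(** * The winding set and its good parameters *)

Section Example.
Context {R : realType}.
Implicit Types (s b u v : R) (E : set (R * R)).

Definition winding_set : set (R * R) :=
  near_graph (fun m => m%:R * slope m).

Lemma winding_set_le E a b l : E `<=` winding_set -> 1 <= l ->
  (counting (E `&` square a b l) <= (15 * l)%:E)%E.
Proof.
move=> EW l1; have l0 : 0 <= l by lra.
apply: le_trans (le_trans (counting_near_graph (fun m => m%:R * slope m) a l l0) _).
  by apply: le_counting => z [/EW Ez [za _]].
by rewrite lee_fin; lra.
Qed.

(** In k consecutive columns where the curve stays within 1 of the line, the least integer above the
    line lies in the strip and within 2 of the curve. *)
Lemma winding_set_along_line s b k : 0 < s -> (0 < k)%N -> exists a a',
  (k%:R%:E <= counting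
     ((winding_set `&`
       [set z : R * R | (s * z.1 + b < z.2 <= s * z.1 + b + 1)%R]) `&`
      square a a' ((s + 2) * k%:R)) :> \bar R)%E.
Proof.
move=> s0 k0.
(* Beyond |b|/s the line is nonnegative, so rounding yields natural numbers. *)
have [m0 [m0M Hm0]] := slope_follows_line s b k (Num.trunc (`|b| / s)).+1.
have sb0 m : (m0 <= m)%N -> 0 <= s * m%:R + b.
  move=> m0m; have : `|b| / s < m%:R.
    by rewrite (lt_le_trans (truncnS_gt _))// ler_nat (leq_trans m0M).
  rewrite ltr_pdivrMr// mulrC => h.
  by have := ler_norm (- b); rewrite normrN; lra.
pose n m := (Num.trunc (s * m%:R + b)).+1.
have nP m : (m0 <= m)%N -> s * m%:R + b < (n m)%:R <= s * m%:R + b + 1.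
  by move=> /sb0 h; rewrite truncnS_gt /n -natr1 lerD2r truncn_le h.
pose t : seq (R * R) := [seq ((m0 + i)%:R, (n (m0 + i)%N)%:R) | i <- iota 0 k].
(* Over k columns the line rises by at most s k and the strip adds 1, so side (s + 2) k suffices. *)
exists m0%:R, (s * m0%:R + b).
have szt : size t = k by rewrite size_map size_iota.
rewrite -{1}szt.
apply: size_le_counting.
  rewrite map_inj_uniq ?iota_uniq// => i j [] /eqP.
  by rewrite eqr_nat eqn_add2l => /eqP.
move=> z /= /mapP[i]; rewrite mem_iota add0n => /= ik ->.
have /andP[n1 n2] := nP _ (leq_addr i m0).
have := Hm0 i ik; rewrite ler_norml => /andP[h1 h2].
have k1 : 1 <= k%:R :> R by rewrite ler1n.
have iR : i%:R <= k%:R :> R by rewrite ler_nat ltnW.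
have i0 : 0 <= i%:R :> R by [].
split; first split => /=.
- exists (m0 + i)%N, (n (m0 + i)%N); split=> //.
  by rewrite ler_norml; apply/andP; split; lra.
- by rewrite n1 n2.
have sik : s * i%:R <= s * k%:R by rewrite ler_pM2l.
have si0 : 0 <= s * i%:R by rewrite mulr_ge0 ?(ltW s0).
move: n1 n2; rewrite natrD mulrDr => n1 n2.
split; rewrite /= in_itv/=; apply/andP; split; rewrite ?natrD; nra.
Qed.

(** Serves both for the whole set and for its part in a tube. *)
Lemma counting_dim_winding_set_along E s b : 0 < s ->
  winding_set `&` [set z : R * R | (s * z.1 + b < z.2 <= s * z.1 + b + 1)%R]
    `<=` E ->
  E `<=` winding_set ->
  counting_dim E = 1%E.
Proof.
move=> s0 lE EW; apply: (@counting_dim_eq1 _ _ 15 (s + 2)); [lra|lra| |].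
  by move=> a a' l l1; exact: winding_set_le.
move=> k k0; have [a [a' H]] := winding_set_along_line s b k s0 k0.
exists a, a'; apply: le_trans H _; apply: le_counting; exact: setSI.
Qed.

Lemma counting_dim_tube_neg u v : u < 0 ->
  counting_dim (winding_set `&` tube u v) = 1%E.
Proof.
move=> u0; apply: (@counting_dim_winding_set_along _ (- u^-1)
  (v * Num.sqrt (1 + (u ^+ 2)^-1))); last exact: subIsetl.
  by rewrite oppr_gt0 invr_lt0.
apply: setIS => z; rewrite /tube lt_eqF//= => /andP[-> zle].
rewrite (le_trans zle)//.
(* The vertical thickness of the tube is at least 1. *)
rewrite -addrA lerD2l mulrDl mul1r lerD2l -[leLHS]sqrtr1 ler_wsqrtr//.
by rewrite lerDl invr_ge0 sqr_ge0.
Qed.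

(** Only finitely many columns matter: x <= v + 1 if u = 0, while for u > 0 the tube descends and y
    >= 0 forces x <= u (v + 1) w. The two entries of [l] cover these cases. *)
Lemma counting_dim_tube_nonneg u v : 0 <= u ->
  counting_dim (winding_set `&` tube u v) <> 1%E.
Proof.
move=> u0; set w := Num.sqrt (1 + (u ^+ 2)^-1).
pose l := Num.max (`|v| + 1) `|u * ((v + 1) * w)|.
have l0 : 0 <= l by rewrite le_max addr_ge0.
apply: counting_dim_neq1.
apply: le_trans (counting_near_graph (fun m => m%:R * slope m) 0 l l0).
apply: le_counting => z [Ez tz]; split => //=.
move: tz; have [m [n [-> _]]] := Ez; rewrite add0r ler0n /l le_max /tube /=.
case: eqVneq => [_ /andP[_ mv]|u1 /andP[_ nle]].
  by rewrite (le_trans mv)// lerD2r ler_norm.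
have {u0 u1} u0 : 0 < u by rewrite lt_neqAle eq_sym u1.
apply/orP; right; apply: le_trans (ler_norm _).
rewrite -ler_pdivrMl// -subr_ge0 addrC -mulNr.
exact: le_trans nle.
Qed.

Lemma good_parameters_winding_set :
  good_parameters winding_set = `]-oo, 0[%classic `*` [set: R].
Proof.
apply/seteqP; split => [[u v]|[u v]] /=.
  move=> [+ W1]; rewrite W1 => tW; split => //=; rewrite in_itv/= ltNge.
  by apply/negP => u0; exact: (counting_dim_tube_nonneg u v u0).
rewrite in_itv/= => -[u0 _].
have W1 : counting_dim winding_set = 1%E.
  by apply: (@counting_dim_winding_set_along _ 1 0) => //; exact: subIsetl.
by split => //=; rewrite W1; exact: counting_dim_tube_neg.
Qed.

Lemma lebesgue2_left_half (M : R) : 0 < M ->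
  lebesgue2 ((`]-oo, 0[%classic `*` [set: R]) `&` (`[- M, M] `*` `[- M, M]))
  = (2 * M ^+ 2)%:E.
Proof.
move=> M0; rewrite -setXI setTI.
have -> : `]-oo, 0[%classic `&` `[- M, M]%classic = `[- M, 0[%classic :> set R.
  apply/seteqP; split => x /=; rewrite !in_itv/=.
    by move=> [x0 /andP[Mx _]]; rewrite Mx x0.
  by move=> /andP[Mx x0]; rewrite x0 Mx ltW// (lt_trans x0).
rewrite /lebesgue2 product_measure1E//= !lebesgue_measure_itv/= !lte_fin.
rewrite oppr_lt0 M0 gtrN// -!EFinB -EFinM; congr EFin; ring.
Qed.

End Example.

Theorem theorem6 (R : realType) :
  exists E : set (R * R),
    E `<=` nat_points R /\
    measurable (good_parameters E) /\
    exists l : R,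
      0 < l /\
      (lebesgue2 (good_parameters E `&` (`[- M, M] `*` `[- M, M])%R)
         / (((2 * M) ^+ 2)%R)%:E)%E @[M --> +oo%R] --> l%:E.
Proof.
exists winding_set; split; first exact: near_graph_nat.
rewrite good_parameters_winding_set; split; first exact: measurableX.
exists (2^-1); split; first by [].
(* For M > 0 the quotient is exactly 2 M^2 / (2 M)^2 = 1/2. *)
apply: cvg_near_cst; near=> M.
have M0 : 0 < M by near: M; apply: nbhs_pinfty_gt; exact: num_real.
rewrite lebesgue2_left_half// inver gt_eqF ?exprn_gt0 ?mulr_gt0//.
by rewrite -EFinM; congr EFin; field; rewrite gt_eqF.
Unshelve. all: by end_near. Qed.
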